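(* Let $D\ge 2$ and let $\Omega\subset\mathbb{R}^D$ be a closed bounded domain (not necessarily smooth) with interior $\Omega^\circ$ and boundary $\partial\Omega$. Let $X_k\in\Omega^\circ$ and let $A_k$ be a (constant) symmetric positive definite $D\times D$ real matrix. Let $\Psi$ be the (viscosity) solution of the anisotropic Eikonal equation $$\|\nabla\Psi^T A_k\nabla\Psi\|=1\ \text{ and }\ \Psi>0\ \text{ in }\Omega^\circ,\qquad \Psi=0\ \text{ on }\partial\Omega .$$ Then the ellipsoid $\Sigma_k$ centred at $X_k$, oriented according to $A_k$ and tangent to $\partial\Omega$ is $$\Sigma_k=E_k^{\Psi(X_k)},$$ i.e. the tangency value $\overline{\rho}$ of the parameter $\rho$ equals $\Psi(X_k)$.
   Context: The domain $\Omega$ is the union of its interior $\Omega^\circ$, which is open and connected, and its boundary $\partial\Omega$. For $\rho>0$, $E_k^\rho=\{y\in\mathbb{R}^D : (y-X_k)^TA_k^{-1}(y-X_k)=\rho^2\}$ is the ellipsoid centred at $X_k$ and oriented according to $A_k$. There is one value $\overline{\rho}>0$ of $\rho$ such that $E_k^{\overline{\rho}}$ is tangent to $\partial\Omega$, and one sets $\Sigma_k:=E_k^{\overline{\rho}}$. Here tangent means that, as $\rho$ grows from $0$, the ellipsoid $E_k^{\rho}$ touches $\partial\Omega$ for the first time at $\rho=\overline{\rho}$. $\|\cdot\|$ is the Euclidean norm (absolute value for scalars). The matrix $A_k$ is the value at the fixed point $X_k$ and fixed time of a matrix-valued coefficient $A(x,t)$; it is held constant in the Eikonal equation. *)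

(* Defs.v *)
From HB Require Import structures.
From mathcomp Require Import all_boot all_order all_algebra.
From mathcomp Require Import all_classical all_reals all_analysis.

Set Implicit Arguments.
Unset Strict Implicit.
Unset Printing Implicit Defensive.

Import Order.TTheory GRing.Theory Num.Theory.
Import numFieldNormedType.Exports.

Local Open Scope classical_set_scope.
Local Open Scope ring_scope.

(* The library normed structure on 'cV[R]_D is the sup norm; it is used below
   only through the topology, boundedness, differentiability and continuity,
   which coincide with the Euclidean ones. *)

Definition boundary (T : topologicalType) (S : set T) : set T :=
  closure S `\` interior S.

Definition closed_bounded_domain (R : realType) (D : nat)
    (Omega : set 'cV[R]_D) : Prop :=
  [/\ Omega = interior Omega `|` boundary Omega,
      connected (interior Omega)
    & bounded_set Omega].

Definition qform (R : realType) (D : nat) (B : 'M[R]_D) (v : 'cV[R]_D) : R :=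
  (v^T *m B *m v) 0 0.

Definition sym_pos_def (R : realType) (D : nat) (A : 'M[R]_D) : Prop :=
  A^T = A /\ forall v : 'cV[R]_D, v != 0 -> 0 < qform A v.

Definition grad (R : realType) (D : nat) (phi : 'cV[R]_D -> R)
    (x : 'cV[R]_D) : 'cV[R]_D :=
  \col_(i < D) 'D_(delta_mx i 0) phi x.

Definition C1_on (R : realType) (D : nat) (U : set 'cV[R]_D)
    (phi : 'cV[R]_D -> R) : Prop :=
  forall x, U x -> differentiable phi x /\ {for x, continuous (grad phi)}.

(* Viscosity sub-, super- and solutions of H(grad u) = 0 in an open set U, for
   functions u that are continuous on U (so that no semicontinuous envelopes
   are needed).  The notion depends on the sign of H: subsolutions satisfy
   H <= 0. *)
Definition viscosity_subsolution (R : realType) (D : nat) (U : set 'cV[R]_D)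
    (H : 'cV[R]_D -> R) (u : 'cV[R]_D -> R) : Prop :=
  forall (phi : 'cV[R]_D -> R) (x0 : 'cV[R]_D),
    C1_on U phi -> U x0 ->
    (\forall x \near x0, u x - phi x <= u x0 - phi x0) ->
    H (grad phi x0) <= 0.

Definition viscosity_supersolution (R : realType) (D : nat) (U : set 'cV[R]_D)
    (H : 'cV[R]_D -> R) (u : 'cV[R]_D -> R) : Prop :=
  forall (phi : 'cV[R]_D -> R) (x0 : 'cV[R]_D),
    C1_on U phi -> U x0 ->
    (\forall x \near x0, u x0 - phi x0 <= u x - phi x) ->
    0 <= H (grad phi x0).

Definition viscosity_solution (R : realType) (D : nat) (U : set 'cV[R]_D)
    (H : 'cV[R]_D -> R) (u : 'cV[R]_D -> R) : Prop :=
  viscosity_subsolution U H u /\ viscosity_supersolution U H u.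

(* Psi is only constrained on Omega; its values elsewhere are irrelevant.
   Continuity up to the boundary gives the Dirichlet condition its meaning. *)
Definition eikonal_solution (R : realType) (D : nat) (Omega : set 'cV[R]_D)
    (A : 'M[R]_D) (Psi : 'cV[R]_D -> R) : Prop :=
  [/\ {within Omega, continuous Psi},
      viscosity_solution (interior Omega) (fun p => `|qform A p| - 1) Psi,
      forall x, interior Omega x -> 0 < Psi x
    & forall x, boundary Omega x -> Psi x = 0].

Definition ellipsoid (R : realType) (D : nat) (X : 'cV[R]_D) (A : 'M[R]_D)
    (rho : R) : set 'cV[R]_D :=
  [set y | qform (invmx A) (y - X) = rho ^+ 2].

(* rho is the first parameter, growing from 0, at which the ellipsoid meets
   the boundary of Omega. *)
Definition tangency_value (R : realType) (D : nat) (Omega : set 'cV[R]_D)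
    (X : 'cV[R]_D) (A : 'M[R]_D) (rho : R) : Prop :=
  [/\ 0 < rho,
      ellipsoid X A rho `&` boundary Omega !=set0
    & forall r, 0 < r < rho -> ellipsoid X A r `&` boundary Omega = set0].

Definition tangent_ellipsoid (R : realType) (D : nat) (Omega : set 'cV[R]_D)
    (X : 'cV[R]_D) (A : 'M[R]_D) (Sigma : set 'cV[R]_D) : Prop :=
  exists rho, tangency_value Omega X A rho /\ Sigma = ellipsoid X A rho.

(* Main.v *)
Require Import Defs.
From mathcomp Require Import all_boot all_order all_algebra.
From mathcomp Require Import all_classical all_reals all_analysis.
From mathcomp Require Import ring lra.
Import Order.TTheory GRing.Theory Num.Theory.
Import numFieldNormedType.Exports.
Local Open Scope classical_set_scope.
Local Open Scope ring_scope.

Set Implicit Arguments.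
Unset Strict Implicit.
Unset Printing Implicit Defensive.

(** Write B for the inverse of A, q(v) = v^T B v and N(v) = sqrt(q(v)).  The
    ellipsoid of parameter rho is the N-sphere of radius rho centred at X, so
    the first parameter at which it meets the boundary is the N-distance from X
    to the boundary.  Everything therefore rests on the identity
    Psi(x) = min (N(x - y), y in the boundary) at interior points x, which is
    proved as two inequalities by comparison arguments.  The link with the
    equation is that grad (h o q)(. - y) = 2 h'(q) B(. - y) and that
    (B v)^T A (B v) = q(v): a radial test function turns the Hamiltonian into
    (2 h')^2 q - 1.

    Upper bound ([eikonal_le_anorm]).  Fix y in the boundary and L > 1.  The
    cone L N(. - y) is smooth in the interior, because its vertex lies on the
    boundary, and its Hamiltonian there is L^2 - 1 > 0.  So Psi - L N(. - y),
    which attains its maximum on the compact Omega, cannot attain it in the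
    interior, by the subsolution property; on the boundary it is at most 0.
    Then L tends to 1.

    Lower bound ([adist_le_eikonal]).  The distance d to the boundary is
    1-Lipschitz for N but not smooth, so variables are doubled.  If
    Psi(x0) < d(x0), take th < 1 with th d(x0) > Psi(x0) and maximise
    th d(x) - Psi(z) - k q(x - z) over Omega x Omega.  For k large neither x
    nor z can be on the boundary at a maximum.  At an interior maximum the
    supersolution property in z gives 2 k N(x - z) >= 1
    ([doubling_slope_ge]), while moving x towards z and using the Lipschitz
    bound gives 2 k N(x - z) <= th ([doubling_slope_le]): a contradiction.

    The boundary is nonempty for the same reason: a minimum of Psi over Omega
    in the interior would contradict the supersolution property tested with a
    constant ([eikonal_boundary_nonempty]). *)

(** * The norm of a positive definite quadratic form *)

Section AnisotropicNorm.
Context {R : realType} {D : nat}.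
Implicit Types (A B : 'M[R]_D) (u v w : 'cV[R]_D).

Definition bform B u v : R := (u^T *m B *m v) 0 0.

Definition anorm B v : R := Num.sqrt (qform B v).

Lemma qformD B u v : B^T = B ->
  qform B (u + v) = qform B u + 2 * bform B u v + qform B v.
Proof.
move=> symB; have sym_uv : (v^T *m B *m u) 0 0 = (u^T *m B *m v) 0 0.
  rewrite -[in LHS]symB -[in LHS](trmxK u) -!trmx_mul mulmxA.
  by rewrite [LHS]mxE.
rewrite /qform /bform [(u + v)^T]linearD/= !mulmxDl !mulmxDr.
have mxD (M N : 'M[R]_1) : (M + N) 0 0 = M 0 0 + N 0 0 by rewrite mxE.
rewrite !mxD.
by rewrite sym_uv; ring.
Qed.

Lemma qformZ B a v : qform B (a *: v) = a ^+ 2 * qform B v.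
Proof.
rewrite /qform [(a *: _)^T]linearZ/= -!scalemxAl -scalemxAr !mxE; ring.
Qed.

Lemma bformZr B a u v : bform B u (a *: v) = a * bform B u v.
Proof. by rewrite /bform -scalemxAr mxE. Qed.

Lemma bformZl B a u v : bform B (a *: u) v = a * bform B u v.
Proof. by rewrite /bform [(a *: _)^T]linearZ/= -!scalemxAl mxE. Qed.

Lemma qform0 B : qform B 0 = 0.
Proof. by rewrite /qform mulmx0 mxE. Qed.

(** A row vector w in the kernel of A^T has A w^T = 0, hence quadratic form 0,
    so definiteness forces w = 0. *)
Lemma sym_pos_def_unit A : sym_pos_def A -> A \in unitmx.
Proof.
move=> [_ posA]; rewrite -unitmx_tr -row_free_unit -kermx_eq0.
apply/negPn/negP => kerN0.
have /rowV0Pn[w /sub_kermxP wA w0] := kerN0.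
have := posA w^T; rewrite trmx_eq0 => /(_ w0).
by rewrite /qform -mulmxA -[A]trmxK -trmx_mul wA trmx0 mulmx0 mxE ltxx.
Qed.

(** The dual norm identity that computes the Hamiltonian of radial functions:
    their gradients are multiples of [invmx A *m v]. *)
Lemma qform_invmx A v : sym_pos_def A ->
  qform A (invmx A *m v) = qform (invmx A) v.
Proof.
move=> spdA; have uA := sym_pos_def_unit spdA.
have symB : (invmx A)^T = invmx A by rewrite trmx_inv spdA.1.
by rewrite /qform trmx_mul symB -!mulmxA (mulmxA A) mulmxV// mul1mx.
Qed.

Lemma sym_pos_def_invmx A : sym_pos_def A -> sym_pos_def (invmx A).
Proof.
move=> spdA; have uA := sym_pos_def_unit spdA; split.
  by rewrite trmx_inv spdA.1.
move=> v v0; rewrite -qform_invmx//; apply: spdA.2.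
by apply: contra_neq v0 => Bv0; rewrite -[v](mulKVmx uA) Bv0 mulmx0.
Qed.

Section Norm.
Variable B : 'M[R]_D.
Hypothesis spdB : sym_pos_def B.

Lemma qform_ge0 v : 0 <= qform B v.
Proof.
by have [->|/spdB.2/ltW//] := eqVneq v 0; rewrite qform0.
Qed.

Lemma anorm_ge0 v : 0 <= anorm B v. Proof. exact: sqrtr_ge0. Qed.

Lemma anorm_gt0 v : v != 0 -> 0 < anorm B v.
Proof. by move=> v0; rewrite sqrtr_gt0 spdB.2. Qed.

Lemma anorm0 : anorm B 0 = 0. Proof. by rewrite /anorm qform0 sqrtr0. Qed.

Lemma sqr_anorm v : anorm B v ^+ 2 = qform B v.
Proof. by rewrite sqr_sqrtr ?qform_ge0. Qed.

Lemma anormZ a v : 0 <= a -> anorm B (a *: v) = a * anorm B v.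
Proof.
by move=> a0; rewrite /anorm qformZ sqrtrM ?sqr_ge0// sqrtr_sqr ger0_norm.
Qed.

Lemma anormN v : anorm B (- v) = anorm B v.
Proof. by rewrite /anorm -scaleN1r qformZ sqrrN expr1n mul1r. Qed.

Lemma anormBC u v : anorm B (u - v) = anorm B (v - u).
Proof. by rewrite -anormN opprB. Qed.

(** Cauchy-Schwarz, from the nonnegativity of the form at the combination
    N(v) u - N(u) v, which would vanish for positively collinear vectors. *)
Lemma bform_le_anorm u v : bform B u v <= anorm B u * anorm B v.
Proof.
have [->|u0] := eqVneq u 0.
  by rewrite -(scale0r 0) bformZl mul0r mulr_ge0// anorm_ge0.
have [->|v0] := eqVneq v 0.
  by rewrite -(scale0r 0) bformZr mul0r mulr_ge0// anorm_ge0.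
have nu := anorm_gt0 u0; have nv := anorm_gt0 v0.
have := qform_ge0 (anorm B v *: u + (- anorm B u) *: v).
rewrite qformD ?spdB.1// !qformZ bformZl bformZr -!sqr_anorm => h.
have {}h : 0 <= (anorm B u * anorm B v) * (anorm B u * anorm B v - bform B u v).
  nra.
by rewrite -subr_ge0 -(pmulr_rge0 _ (mulr_gt0 nu nv)).
Qed.

Lemma anormD u v : anorm B (u + v) <= anorm B u + anorm B v.
Proof.
have sge0 : 0 <= anorm B u + anorm B v by rewrite addr_ge0 ?anorm_ge0.
rewrite -(@ler_pXn2r _ 2)// ?nnegrE ?anorm_ge0//.
rewrite sqr_anorm qformD ?spdB.1// -!sqr_anorm.
have := bform_le_anorm u v; nra.
Qed.

End Norm.
End AnisotropicNorm.

(** * Topology of column vectors *)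

Section MatrixTopology.
Context {R : realType}.

Lemma cvg_mx (T : Type) (F : set_system T) {FF : Filter F} m n
    (f : T -> 'M[R]_(m, n)) (M : 'M[R]_(m, n)) :
  (forall i j, (fun x => f x i j) @ F --> M i j) -> f @ F --> M.
Proof.
move=> fM; apply/cvg_ballP => e e0.
have : \forall x \near F, forall i j, ball (M i j) e (f x i j).
  apply: filter_forall => i; apply: filter_forall => j.
  by move/cvg_ballP : (fM i j); apply.
by apply: filterS => x fx; split.
Qed.

Lemma mulmxl_continuous m n p (B : 'M[R]_(m, n)) :
  continuous (fun x : 'M[R]_(n, p) => B *m x).
Proof.
move=> x; apply: (@cvg_mx _ _ (nbhs_filter x)) => i j; rewrite mxE.
under eq_fun do rewrite mxE.
apply: cvg_big => [|k _]; first exact: add_continuous.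
by apply: cvgM; [exact: cvg_cst|exact: coord_continuous].
Qed.

(** Heine-Borel for columns: a bounded set lies in the transpose of a compact
    cube of rows. *)
Lemma bounded_closed_compact_cV D (A : set 'cV[R]_D) :
  bounded_set A -> closed A -> compact A.
Proof.
move=> [M [Mreal normAltM]] Acl.
pose K := [set v : 'rV[R]_D |
  forall i, `[(- (M + 1)), (M + 1)]%classic (v ord0 i)].
have Kco : compact K.
  apply: (@rV_compact _  _ (fun=> `[(- (M + 1)), (M + 1)]%classic)) => _.
  exact: segment_compact.
have trK : compact ((fun v : 'rV[R]_D => v^T) @` K).
  apply: continuous_compact => //; apply: continuous_subspaceT => v.
  apply: (@cvg_mx _ _ (nbhs_filter v)) => i j; rewrite mxE.
  under eq_fun do rewrite mxE.
  exact: coord_continuous.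
apply: (subclosed_compact Acl trK) => v Av; exists v^T; last exact: trmxK.
move=> i; rewrite mxE /=.
have vM : `|v| <= M + 1 by apply: normAltM => //; rewrite ltrDl.
rewrite in_itv/= -ler_norml; apply: le_trans vM.
rewrite [leRHS]/Num.norm /= mx_normrE.
by apply/bigmax_geP; right => /=; exists (i, ord0).
Qed.

End MatrixTopology.

(** * Radial test functions *)

Section TestFunctions.
Context {R : realType} {D : nat}.
Implicit Types (x y v : 'cV[R]_D).
Variable (B : 'M[R]_D).
Hypothesis symB : B^T = B.

Lemma differentiable_qform y x :
  differentiable (fun z => qform B (z - y)) x.
Proof.
have -> : (fun z => qform B (z - y)) =
    \sum_(j < D) (fun z =>
      (\sum_(i < D) (fun z => (z - y) i 0 * B i j)) z * (z - y) j 0).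
  apply/funext => z; rewrite fct_sumE /qform mxE; apply: eq_bigr => j _.
  by rewrite fct_sumE mxE; under eq_bigr do rewrite mxE.
have dc i : differentiable (fun z => (z - y) i 0) x.
  rewrite (_ : (fun z => (z - y) i 0) =
    (fun z : 'cV[R]_D => z i 0 - y i 0)); last first.
    by apply/funext => z; rewrite !mxE.
  by apply: differentiableB => //; exact: differentiable_coord.
apply: differentiable_sum => j; apply: differentiableM => //.
by apply: differentiable_sum => i; apply: differentiableM.
Qed.

Lemma derive_qform y x v :
  'D_v (fun z => qform B (z - y)) x = 2 * bform B v (x - y).
Proof.
apply: cvg_lim => //.
apply: (@cvg_trans _
  ((fun t : R => 2 * bform B v (x - y) + t * qform B v) @ 0^')).
  apply: near_eq_cvg; near=> t.
  have t0 : t != 0 by near: t; exact: nbhs_dnbhs_neq.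
  rewrite /= -addrA qformD// qformZ bformZl [_ *: _]/GRing.scale/=.
  by field.
suff : (fun t : R => 2 * bform B v (x - y) + t * qform B v) @ 0^' -->
    2 * bform B v (x - y) + 0 * qform B v by rewrite mul0r addr0.
apply: cvgD; first exact: cvg_cst.
by apply: cvgM; [exact: nbhs_dnbhs|exact: cvg_cst].
Unshelve. all: by end_near. Qed.

Lemma qform_continuous y : continuous (fun z : 'cV[R]_D => qform B (z - y)).
Proof.
by move=> x; apply: differentiable_continuous; exact: differentiable_qform.
Qed.

Lemma bform_delta i v : bform B (delta_mx i 0) v = (B *m v) i 0.
Proof. by rewrite /bform trmx_delta -mulmxA -rowE mxE. Qed.

Lemma radial_differentiable y x (h : R -> R) (dh : R) :
  is_derive (qform B (x - y)) 1 h dh ->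
  differentiable (fun z => h (qform B (z - y))) x.
Proof.
move=> hd; apply: (differentiable_comp (differentiable_qform y x)).
by apply/derivable1_diffP.
Qed.

Lemma grad_radial y x (h : R -> R) (dh : R) :
  is_derive (qform B (x - y)) 1 h dh ->
  grad (fun z => h (qform B (z - y))) x = (2 * dh) *: (B *m (x - y)).
Proof.
move=> hd; apply/colP => i; rewrite [LHS]mxE [RHS]mxE -[in RHS]bform_delta.
have hdiff : differentiable h (qform B (x - y)) by apply/derivable1_diffP.
have qdiff := differentiable_qform y x.
rewrite deriveE; last exact: radial_differentiable hd.
rewrite (diff_comp qdiff hdiff) /= (diff1E hdiff) -deriveE// derive_qform.
by rewrite derive1E derive_val [_ *: _]/GRing.scale/=; ring.
Qed.

(** The derivative of [h] is only required at the values taken on [U], which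
    admits cones: [h] is then a multiple of the square root, whose derivative
    is singular at the vertex. *)
Lemma C1_radial (U : set 'cV[R]_D) y (h h' : R -> R) : open U ->
  (forall x, U x -> is_derive (qform B (x - y)) 1 h (h' (qform B (x - y)))) ->
  (forall x, U x -> {for qform B (x - y), continuous h'}) ->
  C1_on U (fun z => h (qform B (z - y))).
Proof.
move=> oU hd ch' x Ux; split; first exact: radial_differentiable (hd x Ux).
rewrite /prop_for/= /continuous_at (grad_radial (hd x Ux)).
apply: (@cvg_trans _
  ((fun z => (2 * h' (qform B (z - y))) *: (B *m (z - y))) @ x)).
  apply: near_eq_cvg; first exact: nbhs_filter.
  have nU : \forall z \near x, U z by exact: open_nbhs_nbhs.
  by apply: filterS nU => z Uz; rewrite (grad_radial (hd z Uz)).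
have FF : Filter (nbhs x) := nbhs_filter x.
have cq : (fun z => h' (qform B (z - y))) @ x --> h' (qform B (x - y)).
  exact: cvg_comp (qform_continuous (y := y) (x := x)) (ch' x Ux).
have cs : (fun z => 2 * h' (qform B (z - y))) @ x --> 2 * h' (qform B (x - y)).
  exact: (cvgM (cvg_cst (2 : R)) cq).
have cB : (fun z : 'cV[R]_D => z - y) @ x --> x - y.
  exact: (cvgB cvg_id (cvg_cst y)).
have cBm : (fun z => B *m (z - y)) @ x --> B *m (x - y).
  exact: cvg_comp cB (mulmxl_continuous (B := B) (x := x - y)).
exact: (cvgZ cs cBm).
Qed.

End TestFunctions.

(** * Distance to a set in an anisotropic norm *)

Section Continuity.
Context {R : realType} {D : nat}.
Variable B : 'M[R]_D.

Lemma anorm_continuous (y : 'cV[R]_D) :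
  continuous (fun z : 'cV[R]_D => anorm B (z - y)).
Proof.
move=> x; have := @sqrt_continuous R (qform B (x - y)).
exact: cvg_comp (@qform_continuous _ _ B y x).
Qed.

Lemma qformB_continuous :
  continuous (fun p : 'cV[R]_D * 'cV[R]_D => qform B (p.1 - p.2)).
Proof.
move=> p.
have FF : Filter (nbhs p) := nbhs_filter p.
have cB : (fun q : 'cV[R]_D * 'cV[R]_D => q.1 - q.2) @ p --> p.1 - p.2.
  exact: (cvgB cvg_fst cvg_snd).
have cq := @qform_continuous _ _ B 0 (p.1 - p.2).
rewrite /continuous_at subr0 in cq.
apply: (cvg_trans _ (cvg_comp _ _ cB cq)).
by apply: near_eq_cvg; apply: nearW => q /=; rewrite subr0.
Qed.

End Continuity.

Section DistanceToSet.
Context {R : realType} {D : nat}.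
Variables (B : 'M[R]_D) (S : set 'cV[R]_D).
Hypotheses (spdB : sym_pos_def B) (S0 : S !=set0).
Implicit Types x y z : 'cV[R]_D.

Definition adist x : R := inf [set anorm B (x - y) | y in S].

Lemma adist_has_inf x : has_inf [set anorm B (x - y) | y in S].
Proof.
split; first exact: image_nonempty.
by exists 0 => _ [y _ <-]; exact: anorm_ge0.
Qed.

Lemma adist_le x y : S y -> adist x <= anorm B (x - y).
Proof.
by move=> Sy; apply: ge_inf; [exact: (adist_has_inf x).2|exists y].
Qed.

Lemma le_adist x a : (forall y, S y -> a <= anorm B (x - y)) -> a <= adist x.
Proof.
move=> ale; apply: lb_le_inf; first exact: (adist_has_inf x).1.
by move=> _ [y Sy <-]; exact: ale.
Qed.

Lemma adist_on x : S x -> adist x = 0.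
Proof.
move=> Sx; apply/eqP; rewrite eq_le; apply/andP; split.
  by rewrite (le_trans (adist_le _ Sx))// subrr anorm0.
by apply: le_adist => y _; exact: anorm_ge0.
Qed.

Lemma adist_lipschitz x z : adist x <= adist z + anorm B (x - z).
Proof.
rewrite -lerBlDr; apply: le_adist => y Sy; rewrite lerBlDr.
apply: (le_trans (adist_le x Sy)).
have -> : x - y = (z - y) + (x - z) by rewrite [RHS]addrC subrKA.
exact: anormD.
Qed.

Lemma adist_continuous : continuous adist.
Proof.
move=> x; have FF : Filter (nbhs x) := nbhs_filter x.
apply/cvgrPdist_le => e e0.
have := @anorm_continuous _ _ B x x; rewrite /continuous_at subrr anorm0.
move/cvgrPdist_le => /(_ e e0); apply: filterS => z.
rewrite sub0r normrN ger0_norm ?anorm_ge0// => ze.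
have h1 := adist_lipschitz x z; have h2 := adist_lipschitz z x.
rewrite anormBC in h1.
by rewrite ler_norml; apply/andP; split; lra.
Qed.

End DistanceToSet.

(** * Doubling of variables *)

Section Doubling.
Context {R : realType} {D : nat}.
Variable B : 'M[R]_D.
Hypothesis spdB : sym_pos_def B.
Implicit Types (O : set 'cV[R]_D) (x z w : 'cV[R]_D) (f g : 'cV[R]_D -> R).

Lemma doubling_continuous O f g k :
  continuous f -> {within O, continuous g} ->
  {within O `*` O, continuous
     (fun p => f p.1 - g p.2 - k * qform B (p.1 - p.2))}.
Proof.
move=> cf cg; apply/subspace_continuousP => -[a b] [/= Oa Ob].
have FF : Filter (within (O `*` O) (nbhs (a, b))) by exact: within_filter.
have c1 : f p.1 @[p --> within (O `*` O) (nbhs (a, b))] --> f a.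
  apply: cvg_within_filter.
  by move=> W /cf; exact: (@cvg_fst _ _ (nbhs a) (nbhs b)).
have c2 : g p.2 @[p --> within (O `*` O) (nbhs (a, b))] --> g b.
  move=> W gW; have := (subspace_continuousP _ _).1 cg b Ob W gW.
  move=> /(@cvg_snd _ _ (nbhs a) (nbhs b)) nW.
  apply: (@filterS _ _ (nbhs_filter (a, b)) _ _ _ nW) => -[u v] /= Wv [_ Ov].
  exact: Wv.
have c3 : qform B (p.1 - p.2) @[p --> within (O `*` O) (nbhs (a, b))]
    --> qform B (a - b).
  apply: cvg_within_filter.
  exact: (@qformB_continuous R D B (a, b)).
apply: cvgB; first exact: cvgB.
by apply: cvgM => //; exact: cvg_cst.
Qed.

(** The points [x - t *: w] with [t > 0] small are the competitors of [x] in the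
    first-order argument of [doubling_slope_le]. *)
Lemma nbhs_backward O x w : nbhs x O ->
  \forall t \near (0 : R)^'+, O (x - t *: w).
Proof.
have cx : x - t *: w @[t --> (0 : R)] --> x.
  have := cvgB (cvg_cst x) (cvgZ (@cvg_id _ (nbhs (0 : R))) (cvg_cst w)).
  by rewrite scale0r subr0; exact.
by move=> xO; exact: (cvg_at_right_filter cx xO).
Qed.

(** Replacing x by x - t (x - z) decreases k q(x - z) by
    k N(x - z)^2 (2 t - t^2) and f by at most th t N(x - z); comparing the two
    to first order in t bounds the slope 2 k N(x - z) of the penalty. *)
Lemma doubling_slope_le O f x z (k th : R) : 0 < k -> 0 <= th ->
  (forall u v, f u <= f v + th * anorm B (u - v)) ->
  interior O x ->
  (forall u, O u ->
     f u - k * qform B (u - z) <= f x - k * qform B (x - z)) ->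
  2 * k * anorm B (x - z) <= th.
Proof.
move=> k0 th0 lipf Ux xmax; set s := anorm B (x - z).
have [s0|] := eqVneq s 0; first by rewrite s0 mulr0.
rewrite neq_lt ltNge anorm_ge0 /= => s0.
have ks : 0 < k * s by exact: mulr_gt0.
rewrite leNgt; apply/negP => slope.
have e0 : 0 < (2 * k * s - th) / (k * s) by rewrite divr_gt0// subr_gt0.
near (0 : R)^'+ => t.
have t0 : 0 < t by near: t; exact: nbhs_right_gt.
have Ot : O (x - t *: (x - z)) by near: t; exact: nbhs_backward.
have : t < (2 * k * s - th) / (k * s) by near: t; exact: nbhs_right_lt.
rewrite ltr_pdivlMr// => te.
have lipt : f x <= f (x - t *: (x - z)) + th * (t * s).
  have := lipf x (x - t *: (x - z)).
  have -> : x - (x - t *: (x - z)) = t *: (x - z) by rewrite opprB addrC subrK.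
  by rewrite anormZ// ltW.
have := xmax _ Ot.
have -> : x - t *: (x - z) - z = (1 - t) *: (x - z).
  by rewrite scalerBl scale1r addrAC.
rewrite qformZ -sqr_anorm// -/s => xm.
have {}xm : t * s * (2 * k * s - th - t * (k * s)) <= 0.
  have -> : t * s * (2 * k * s - th - t * (k * s)) =
    k * s ^+ 2 - k * ((1 - t) ^+ 2 * s ^+ 2) - th * (t * s) by ring.
  by lra.
by move: xm; rewrite leNgt mulr_gt0// ?mulr_gt0// subr_gt0.
Unshelve. all: by end_near. Qed.

End Doubling.

(** * Closed bounded domains *)

Section Domain.
Context {R : realType} {D : nat}.
Variable Omega : set 'cV[R]_D.
Hypothesis dOmega : closed_bounded_domain Omega.

Lemma domain_closed : closed Omega.
Proof.
case: dOmega => eqO _ _ x clx; rewrite eqO.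
by have [ix|nix] := pselect (interior Omega x); [left|right].
Qed.

Lemma domain_compact : compact Omega.
Proof.
by case: (dOmega) => _ _ bO; exact: bounded_closed_compact_cV bO domain_closed.
Qed.

Lemma boundary_domain x : boundary Omega x -> Omega x.
Proof. by case: dOmega => eqO _ _ bx; rewrite eqO; right. Qed.

Lemma domain_cases x : Omega x -> interior Omega x \/ boundary Omega x.
Proof. by case: dOmega => eqO _ _; rewrite {1}eqO. Qed.

Lemma boundary_compact : compact (boundary Omega).
Proof.
apply: (subclosed_compact _ domain_compact); last exact: boundary_domain.
apply: closedI; first exact: closed_closure.
by apply: open_closedC; exact: open_interior.
Qed.

End Domain.

(** * Comparison with the eikonal solution *)

Section Eikonal.
Context {R : realType} {D : nat}.
Variables (Omega : set 'cV[R]_D) (A : 'M[R]_D) (Psi : 'cV[R]_D -> R).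
Hypotheses (dOmega : closed_bounded_domain Omega) (spdA : sym_pos_def A).
Hypothesis ePsi : eikonal_solution Omega A Psi.
Implicit Types x y z : 'cV[R]_D.
Local Notation B := (invmx A).

Let spdB : sym_pos_def B. Proof. exact: sym_pos_def_invmx. Qed.
Let symB : B^T = B. Proof. exact: spdB.1. Qed.

Let hamiltonian_radial (c : R) y x :
  `|qform A ((2 * c) *: (B *m (x - y)))| = (2 * c) ^+ 2 * qform B (x - y).
Proof.
by rewrite qformZ qform_invmx// ger0_norm// mulr_ge0 ?sqr_ge0 ?qform_ge0.
Qed.

Lemma subsolution_radial_test y (h h' : R -> R) x0 :
  (forall x, interior Omega x ->
     is_derive (qform B (x - y)) 1 h (h' (qform B (x - y)))) ->
  (forall x, interior Omega x -> {for qform B (x - y), continuous h'}) ->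
  interior Omega x0 ->
  (forall x, Omega x ->
     Psi x - h (qform B (x - y)) <= Psi x0 - h (qform B (x0 - y))) ->
  (2 * h' (qform B (x0 - y))) ^+ 2 * qform B (x0 - y) <= 1.
Proof.
case: ePsi => _ [sub _] _ _ hd ch' Ux0 mx.
have := sub _ x0 (C1_radial symB (open_interior _) hd ch') Ux0.
rewrite (grad_radial symB (hd _ Ux0)) hamiltonian_radial subr_le0; apply.
by apply: filterS Ux0; exact: mx.
Qed.

Lemma supersolution_radial_test y (h h' : R -> R) x0 :
  (forall x, interior Omega x ->
     is_derive (qform B (x - y)) 1 h (h' (qform B (x - y)))) ->
  (forall x, interior Omega x -> {for qform B (x - y), continuous h'}) ->
  interior Omega x0 ->
  (forall x, Omega x ->
     Psi x0 - h (qform B (x0 - y)) <= Psi x - h (qform B (x - y))) ->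
  1 <= (2 * h' (qform B (x0 - y))) ^+ 2 * qform B (x0 - y).
Proof.
case: ePsi => _ [_ sup] _ _ hd ch' Ux0 mx.
have := sup _ x0 (C1_radial symB (open_interior _) hd ch') Ux0.
rewrite (grad_radial symB (hd _ Ux0)) hamiltonian_radial subr_ge0; apply.
by apply: filterS Ux0; exact: mx.
Qed.

Lemma eikonal_ge0 x : Omega x -> 0 <= Psi x.
Proof.
case: ePsi => _ _ pos bd /(domain_cases dOmega)[/pos/ltW//|/bd->//].
Qed.

(** An interior minimum of Psi would be touched from below by a constant, whose
    Hamiltonian is -1 < 0. *)
Lemma eikonal_boundary_nonempty : Omega !=set0 -> boundary Omega !=set0.
Proof.
move=> O0; case: (ePsi) => cPsi _ _ _.
have [c /set_mem Oc cmin] := compact_EVT_min O0 (domain_compact dOmega) cPsi.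
have [Uc|] := domain_cases dOmega Oc; last by exists c.
have := @supersolution_radial_test 0 (cst 0) (cst 0) c.
rewrite /= mulr0 expr0n mul0r ler10 => /(_ _ _ Uc) H.
exfalso; suff : false by []; apply: H => x Ux.
- exact: cst_continuous.
- by rewrite !subr0; apply: cmin; exact: mem_set.
Qed.

(** Cones of slope L > 1 with vertex on the boundary are strict supersolutions
    which dominate Psi on the boundary; see the comment at the top. *)
Lemma eikonal_le_anorm x y : Omega x -> boundary Omega y ->
  Psi x <= anorm B (x - y).
Proof.
move=> Ox bdy; case: (ePsi) => cPsi _ _ bd.
suff HL L : 1 < L -> Psi x <= L * anorm B (x - y).
  (* With slope 1 + e / (N + 1) the bound exceeds N by less than e; the + 1
     covers the case N = 0. *)
  apply/ler_addgt0Pr => e e0; set N := anorm B (x - y).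
  have N0 : 0 <= N by exact: anorm_ge0.
  have N1 : 0 < N + 1 by lra.
  have L1 : 1 < 1 + e / (N + 1) by rewrite ltrDl divr_gt0.
  apply: (le_trans (HL _ L1)); rewrite mulrDl mul1r lerD2l -/N.
  by rewrite mulrAC ler_pdivrMr// ler_pM2l//; lra.
move=> L1; have L0 : 0 < L by lra.
have O0 : Omega !=set0 by exists x.
have cF : {within Omega, continuous (fun z => Psi z - L * anorm B (z - y))}.
  apply/subspace_continuousP => z Oz.
  have FF : Filter (within Omega (nbhs z)) by exact: within_filter.
  have cP := (subspace_continuousP _ _).1 cPsi z Oz.
  have cN : anorm B (w - y) @[w --> within Omega (nbhs z)] --> anorm B (z - y).
    by apply: cvg_within_filter; exact: anorm_continuous.
  exact: cvgB cP (cvgM (cvg_cst L) cN).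
have [c /set_mem Oc cmax] := compact_EVT_max O0 (domain_compact dOmega) cF.
have /= := cmax x (mem_set Ox).
have [Uc|bc] := domain_cases dOmega Oc; last first.
  rewrite (bd _ bc) => h; rewrite -subr_le0; apply: (le_trans h).
  by rewrite sub0r oppr_le0 mulr_ge0 ?anorm_ge0// ltW.
have qpos z : interior Omega z -> 0 < qform B (z - y).
  move=> Uz; apply: spdB.2; rewrite subr_eq0; apply/eqP => zy.
  by apply: bdy.2; rewrite -zy.
have := @subsolution_radial_test y (fun r => L * Num.sqrt r)
  (fun r => L * (2 * Num.sqrt r)^-1) c.
have Ncpos : 0 < anorm B (c - y) by rewrite sqrtr_gt0 qpos.
have -> : (2 * (L * (2 * Num.sqrt (qform B (c - y)))^-1)) ^+ 2 * qform B (c - y)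
   = L ^+ 2.
  rewrite -/(anorm B (c - y)) -(sqr_anorm spdB); field.
  by rewrite gt_eqF.
have L2 : (L ^+ 2 <= 1) = false by apply/negbTE; rewrite -ltNge; nra.
rewrite L2 => H _; exfalso; suff : false by []; apply: H => //.
- move=> z Uz; have := is_derive1_sqrt (qpos z Uz) => dz.
  exact: is_deriveZ.
- move=> z Uz.
  have sz : 0 < Num.sqrt (qform B (z - y)) by rewrite sqrtr_gt0 qpos.
  apply: continuousM; first exact: cst_continuous.
  apply: continuousV; first by rewrite mulf_neq0// gt_eqF.
  apply: continuousM; first exact: cst_continuous.
  exact: sqrt_continuous.
- by move=> z Oz; apply: cmax; exact: mem_set.
Qed.

(** In the variable z the penalty is itself a smooth test function touching Psi
    from below; its gradient has dual norm 2 k N(x - z). *)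
Lemma doubling_slope_ge k x z : 0 < k -> interior Omega z ->
  (forall w, Omega w ->
     Psi z + k * qform B (x - z) <= Psi w + k * qform B (x - w)) ->
  1 <= 2 * k * anorm B (x - z).
Proof.
move=> k0 Uz zmin.
have qC u v : qform B (u - v) = qform B (v - u).
  by rewrite -!(sqr_anorm spdB) anormBC.
have := @supersolution_radial_test x (fun r => - k * r) (cst (- k)) z.
move=> /= H; have {}H : 1 <= (2 * - k) ^+ 2 * qform B (z - x).
  apply: H => //.
  - move=> w _; have := is_deriveZ (- k) (is_derive_id (qform B (w - x)) 1).
    by rewrite [_ *: 1]mulr1; exact.
  - by move=> w _; exact: cst_continuous.
  - by move=> w Ow; have := zmin _ Ow; rewrite !mulNr !opprK (qC z) (qC w).
have s0 : 0 <= 2 * k * anorm B (x - z).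
  by rewrite !mulr_ge0 ?anorm_ge0// ltW.
rewrite -(@ler_pXn2r _ 2)// ?nnegrE// expr1n exprMn sqr_anorm//.
by rewrite qC -sqrrN -mulrN.
Qed.

(** Comparison by doubling of variables.  Scaling d by th < 1 makes it a strict
    subsolution, which is what the two slope bounds contradict. *)
Lemma adist_le_eikonal x0 : interior Omega x0 ->
  adist B (boundary Omega) x0 <= Psi x0.
Proof.
move=> Ux0; case: (ePsi) => cPsi _ pos bd.
have Ox0 : Omega x0 by exact: interior_subset.
have bd0 : boundary Omega !=set0 by apply: eikonal_boundary_nonempty; exists x0.
set d := adist B (boundary Omega).
have P0 := pos _ Ux0.
rewrite leNgt; apply/negP => Pd.
have d0 : 0 < d x0 by lra.
pose m := (d x0 - Psi x0) / 2.
have m0 : 0 < m by rewrite /m; lra.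
(* Chosen so that th * d x0 - Psi x0 = m. *)
pose th := (Psi x0 + d x0) / (2 * d x0).
have thd : th * d x0 = (Psi x0 + d x0) / 2.
  by rewrite /th; field; rewrite gt_eqF.
have th0 : 0 < th by rewrite divr_gt0//; lra.
have th1 : th < 1 by rewrite ltr_pdivrMr; lra.
(* Large enough to keep z off the boundary at a maximum: that needs
   th ^+ 2 / (4 * k) < m. *)
pose k := (4 * m)^-1.
have k0 : 0 < k by rewrite invr_gt0; lra.
have km : 4 * k * m = 1 by rewrite /k; field; rewrite gt_eqF.
pose F (p : 'cV[R]_D * 'cV[R]_D) :=
  th * d p.1 - Psi p.2 - k * qform B (p.1 - p.2).
have cF : {within Omega `*` Omega, continuous F}.
  have cd : continuous (fun u => th * d u).
    move=> u; have FF : Filter (nbhs u) := nbhs_filter u.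
    exact: cvgM (cvg_cst th) (adist_continuous spdB bd0 (x := u)).
  exact: (doubling_continuous cd cPsi).
have OO0 : (Omega `*` Omega) !=set0 by exists (x0, x0).
have cOO := compact_setX (domain_compact dOmega) (domain_compact dOmega).
have [[x z] /set_mem/= [Ox Oz] Fmax] := compact_EVT_max OO0 cOO cF.
have Fm : m <= F (x, z).
  have := Fmax (x0, x0) (mem_set (conj Ox0 Ox0)); apply: le_trans.
  by rewrite /F /= subrr qform0 mulr0 subr0 thd /m; lra.
set s := anorm B (x - z).
have s0 : 0 <= s by exact: anorm_ge0.
have qs : qform B (x - z) = s ^+ 2 by rewrite sqr_anorm.
move: Fm; rewrite /F/= qs => Fm.
have [Ux|bx] := domain_cases dOmega Ox; last first.
  have := eikonal_ge0 Oz; move: Fm; rewrite /d adist_on// => ? ?.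
  have : 0 <= k * s ^+ 2 by rewrite mulr_ge0 ?sqr_ge0// ltW.
  by lra.
have [Uz|bz] := domain_cases dOmega Oz; last first.
  (* Completing the square, th * s - k * s ^+ 2 <= th ^+ 2 / (4 * k) < m. *)
  have dxs : th * d x <= th * s by rewrite ler_pM2l//; exact: adist_le.
  have : 4 * k * m <= 4 * k * (th * s - k * s ^+ 2).
    by rewrite ler_pM2l; [move: Fm; rewrite (bd _ bz); lra|lra].
  have := sqr_ge0 (2 * k * s - th).
  have : th ^+ 2 < 1 by rewrite expr_lt1// ltW.
  by rewrite km; nra.
have slope_ge : 1 <= 2 * k * s.
  apply: doubling_slope_ge => // w Ow.
  have := Fmax (x, w) (mem_set (conj Ox Ow)); rewrite /F/=; lra.
have slope_le : 2 * k * s <= th.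
  apply: (@doubling_slope_le _ _ _ spdB Omega (fun u => th * d u)) => //.
  - exact: ltW.
  - by move=> u v; rewrite -mulrDr ler_pM2l//; exact: adist_lipschitz.
  - move=> u Ou; have := Fmax (u, z) (mem_set (conj Ou Oz)); rewrite /F/=; lra.
by lra.
Qed.

Lemma eikonal_min_anorm x : interior Omega x ->
  (exists2 y, boundary Omega y & Psi x = anorm B (y - x)) /\
  (forall y, boundary Omega y -> Psi x <= anorm B (y - x)).
Proof.
move=> Ux; have Ox := interior_subset Ux.
have bd0 : boundary Omega !=set0 by apply: eikonal_boundary_nonempty; exists x.
split; last by move=> y bdy; rewrite anormBC; exact: eikonal_le_anorm.
have cN : {within boundary Omega, continuous (fun y => anorm B (y - x))}.
  by apply: continuous_subspaceT; exact: anorm_continuous.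
have [y /set_mem bdy ymin] := compact_EVT_min bd0 (boundary_compact dOmega) cN.
exists y => //; apply/eqP; rewrite eq_le; apply/andP; split.
  by rewrite anormBC; exact: eikonal_le_anorm.
apply: le_trans (adist_le_eikonal Ux); apply: le_adist => // z bz.
by rewrite [leRHS]anormBC; apply: ymin; exact: mem_set.
Qed.

End Eikonal.

Lemma ellipsoidP (R : realType) (D : nat) (X : 'cV[R]_D) (A : 'M[R]_D) (r : R)
    (y : 'cV[R]_D) : sym_pos_def A -> 0 <= r ->
  ellipsoid X A r y <-> anorm (invmx A) (y - X) = r.
Proof.
move=> spdA r0; rewrite /ellipsoid /=; split => [q|<-].
  by rewrite /anorm q sqrtr_sqr ger0_norm.
by rewrite sqr_anorm//; exact: sym_pos_def_invmx.
Qed.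

(** Neither of two first contact parameters can precede the other. *)
Lemma tangency_value_le (R : realType) (D : nat) (Omega : set 'cV[R]_D)
    (X : 'cV[R]_D) (A : 'M[R]_D) (r s : R) :
  tangency_value Omega X A r -> tangency_value Omega X A s -> r <= s.
Proof.
move=> [_ _ firstr] [s0 [y ys] _]; rewrite leNgt; apply/negP => sr.
have : (ellipsoid X A s `&` boundary Omega) y by [].
by rewrite firstr// s0.
Qed.

Theorem lemma2 (R : realType) (D : nat) (hD : (2 <= D)%N)
    (Omega : set 'cV[R]_D) (hOmega : closed_bounded_domain Omega)
    (Xk : 'cV[R]_D) (hXk : interior Omega Xk)
    (Ak : 'M[R]_D) (hAk : sym_pos_def Ak)
    (Psi : 'cV[R]_D -> R) (hPsi : eikonal_solution Omega Ak Psi) :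
  (forall rho : R, tangency_value Omega Xk Ak rho <-> rho = Psi Xk) /\
  (forall Sigma : set 'cV[R]_D,
     tangent_ellipsoid Omega Xk Ak Sigma <->
     Sigma = ellipsoid Xk Ak (Psi Xk)).
Proof.
have [[y bdy Psiy] Psile] := eikonal_min_anorm hOmega hAk hPsi hXk.
have Psi0 : 0 < Psi Xk by case: hPsi => _ _ pos _; exact: pos.
have tanPsi : tangency_value Omega Xk Ak (Psi Xk).
  split => //.
    by exists y; split=> //; apply/ellipsoidP => //; exact: ltW.
  move=> r /andP[r0 rPsi]; apply/seteqP; split=> // z [ez bz].
  have /ellipsoidP-/(_ hAk (ltW r0)) zr := ez.
  by have := Psile _ bz; rewrite zr leNgt rPsi.
have tanE rho : tangency_value Omega Xk Ak rho <-> rho = Psi Xk.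
  split=> [tanrho|->//]; apply/eqP; rewrite eq_le.
  rewrite (tangency_value_le tanrho tanPsi).
  by rewrite (tangency_value_le tanPsi tanrho).
split=> // Sigma; split=> [[rho [/tanE-> ->]]//|->].
by exists (Psi Xk).
Qed.
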